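(* Let $n\ge 5$ and $2\le s\le \lfloor \frac{n-1}{2}\rfloor$ be integers, and write $n=\lambda s+\gamma$ with integers $\lambda,\gamma$ and $0\le\gamma<s$. Assume that $n$ is odd, $s$ is even, and $\lambda>\gamma>0$. Then $$\mathrm{diam}(C_n(1,s))=\begin{cases}\lceil\frac{\lambda}{2}\rceil+\frac{s-2}{2} & \text{if } \gamma=1 \text{ or } \gamma=s-1,\\ \lfloor\frac{\lambda}{2}\rfloor+\frac{s-\gamma+1}{2} & \text{if } 3\le\gamma\le 2\lceil\frac{s}{4}\rceil-1,\\ \lceil\frac{\lambda}{2}\rceil+\frac{\gamma-1}{2} & \text{otherwise.}\end{cases}$$
   Context: For integers $n\ge5$ and $2\le s\le\lfloor\frac{n-1}{2}\rfloor$, the circulant graph $C_n(1,s)$ is the graph with vertex set $\{0,1,\ldots,n-1\}$ in which two distinct vertices $i,j$ are adjacent if and only if $|i-j|_n\in\{1,s\}$, where $|x|_n=\min(|x|,n-|x|)$. The distance between two vertices is the length (number of edges) of a shortest path joining them, and $\mathrm{diam}$ is the maximum distance over all pairs of vertices. *)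

(* Defs.v *)
From mathcomp Require Import all_boot all_order all_algebra.

Set Implicit Arguments.
Unset Strict Implicit.
Unset Printing Implicit Defensive.

Local Open Scope nat_scope.

Section Distance.
Variables (T : finType) (e : rel T).

Definition has_path_of_length (k : nat) (x y : T) : bool :=
  [exists p : k.-tuple T, [&& path e x p, last x p == y & uniq (x :: p)]].

(* Every simple path has fewer than #|T| edges, so the search is exhaustive;
   vertices joined by no path get the value #|T|, larger than any distance. *)
Definition gdist (x y : T) : nat :=
  find (fun k => has_path_of_length k x y) (iota 0 #|T|).

Definition diam : nat := \max_(x : T) \max_(y : T) gdist x y.

End Distance.

(* |x|_n = min(|x|, n - |x|); the truncated subtraction is exact in
   [circulant], where |i - j| < n. *)
Definition circ_norm (n : nat) (x : int) : nat := minn `|x|%N (n - `|x|%N).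

Definition circulant (n s : nat) : rel 'I_n :=
  fun i j =>
    (i != j) && (circ_norm n (i%:Z - j%:Z)%R \in [:: 1; s]).
Arguments circulant : clear implicits.

Definition ceil_div (m d : nat) : nat := (m + d.-1) %/ d.

(* Main.v *)
Require Import Defs.
From mathcomp Require Import all_boot.
From mathcomp Require Import ssralg ssrint zify.

(**
A walk in C_n(1,s) is a sequence of steps +-1 and +-s, so the distance from 0
to v is the least |a| + |b| with a + b s = v modulo n.  On the integer line,
where the congruence is an equation, the cheapest way to write x = q s + r
(0 <= r < s) either makes q steps of length s and r unit steps forward, or
overshoots with q + 1 steps of length s and makes s - r unit steps back: the
cost is [line_norm s x] = q + min(r, s + 1 - r).  When gamma <= lambda, winding
around the cycle more than once never helps, so the distance from 0 to v is
the smaller of the two costs of reaching v directly in either direction,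
[circ_dist n s v] = min(line_norm s v, line_norm s (n - v)).

The upper bound [gdist_le_circ_dist] just builds these walks.  The lower bound
avoids comparing all pairs (a, b) in a residue class: it suffices that
[circ_dist] vanishes at 0 and changes by at most one along each edge
([circ_dist_lip]).  This is immediate except for steps of length s across 0,
where [line_norm_wrap] uses gamma <= lambda.

It remains to maximise [circ_dist] over v = q s + r.  It is a minimum of four
affine functions of (q, r), and the average of two of them with constant sum
bounds it.  For r <= gamma the two direct costs r + q and
(gamma - r) + (lambda - q) have sum gamma + lambda, whence the bound
floor((lambda + gamma) / 2); for r >= gamma the costs (s + 1 - r) + q and
(r - gamma) + (lambda - q) give floor((lambda + s + 1 - gamma) / 2).  As n is
odd and s even, gamma is odd, and then the larger bound is attained, with one
exception: gamma = 1 and lambda even.  There the costs r + q and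
(s + 1 - r) + (lambda - q - 1) also have sum lambda + s, so reaching the bound
(lambda + s) / 2 forces all four costs to be equal; but r + q and
(r - 1) + (lambda - q) have odd sum, so the maximum drops by one.  The cases of
the formula record which value is the largest.
*)

Set Implicit Arguments.
Unset Strict Implicit.
Unset Printing Implicit Defensive.

(** * Distances in finite graphs *)

Section GraphDistance.

Variables (T : finType) (e : rel T).

Definition walk (k : nat) (x y : T) : Prop :=
  exists p : seq T, [/\ path e x p, last x p = y & size p = k].

Lemma walk_cat k l x y z : walk k x y -> walk l y z -> walk (k + l) x z.
Proof.
move=> [p [pp lp sp]] [p' [pp' lp' sp']]; exists (p ++ p').
by rewrite cat_path last_cat size_cat lp pp pp' sp sp'.
Qed.

Lemma walk_sym k x y : symmetric e -> walk k x y -> walk k y x.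
Proof.
move=> e_sym [p [pp <- <-]]; exists (rev (belast x p)); split.
- by rewrite rev_path (eq_path (e' := e)) // => a b; rewrite e_sym.
- by case: p {pp} => //= a p; rewrite rev_cons last_rcons.
- by rewrite size_rev size_belast.
Qed.

(** [gdist] only searches simple paths, so the walk is first shortened to one,
    which also puts its length within the range searched. *)
Lemma walk_gdist_le k x y : walk k x y -> gdist e x y <= k.
Proof.
move=> [p [pp lp <-]].
case/shortenP: pp lp => p' pp' up' sub_p' lp.
have lt_p' : size p' < #|T|.
  by have := card_uniqP up'; rewrite /= => <-; apply: max_card.
have le_p' : size p' <= size p.
  by apply: uniq_leq_size sub_p'; case/andP: up'.
apply: leq_trans le_p'; rewrite /gdist leqNgt; apply/negP => lt_find.
have := before_find 0 lt_find; rewrite nth_iota // add0n => /negbT/negP; apply.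
by apply/existsP; exists (in_tuple p'); rewrite pp' up' lp eqxx.
Qed.

(** A function growing by at most one per edge certifies lower bounds on
    distances.  The bound by the order of the graph covers the default value
    of [gdist] on pairs joined by no path. *)
Lemma gdist_ge_potential (f : T -> nat) x y :
    (forall a b, e a b -> f b <= (f a).+1) ->
    f x = 0 -> f y <= #|T| -> f y <= gdist e x y.
Proof.
move=> f_lip fx0 fy_le; rewrite /gdist.
set P := fun k => _.
have [P_has|P_no] := boolP (has P (iota 0 #|T|)); last first.
  by rewrite hasNfind // size_iota.
have := nth_find 0 P_has; move: (P_has); rewrite has_find size_iota => lt_find.
rewrite nth_iota // add0n {1}/P /has_path_of_length; move: (find _ _) => k.
move=> /existsP[p].
case/and3P=> pp /eqP <- _; rewrite -[k in _ <= k]add0n -fx0.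
have := size_tuple p; move: (tval p) pp => {fx0 fy_le P_has lt_find P}q + <-.
elim: q x => [|a q IHq] x /=; first by rewrite addn0.
by case/andP=> exa /IHq; have := f_lip _ _ exa; lia.
Qed.

End GraphDistance.

(** * Word length on the integer line *)

(** The least number of steps +-1, +-s from 0 to x on the integer line. *)
Definition line_norm (s x : nat) : nat :=
  x %/ s + minn (x %% s) (s.+1 - x %% s).

Section LineNorm.

Variable s : nat.
Hypothesis s_ge2 : 2 <= s.

(** The case r = s is included: the formula is continuous there, as
    q + min(s, 1) = (q + 1) + min(0, s + 1). *)
Lemma line_normE q r : r <= s ->
  line_norm s (q * s + r) = q + minn r (s.+1 - r).
Proof.
rewrite /line_norm leq_eqVlt => /orP[/eqP->|r_lt].
  by rewrite -mulSnr mulnK ?modnMl; lia.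
by rewrite divnMDl ?modnMDl ?modn_small ?divn_small; lia.
Qed.

Lemma line_norm_small x : x <= s -> line_norm s x = minn x (s.+1 - x).
Proof. exact: (@line_normE 0). Qed.

Lemma line_normDs x : line_norm s (x + s) = (line_norm s x).+1.
Proof.
by rewrite /line_norm divnDr // divnn modnDr; lia.
Qed.

Lemma line_norm_succ x :
  line_norm s x.+1 <= (line_norm s x).+1 /\
  line_norm s x <= (line_norm s x.+1).+1.
Proof.
have r_lt : x %% s < s by rewrite ltn_mod; lia.
by rewrite (divn_eq x s) -addnS !line_normE ?(ltnW r_lt) //; lia.
Qed.

Lemma line_norm_le x : line_norm s x <= x.
Proof.
rewrite {2}(divn_eq x s) /line_norm leq_add ?geq_minl //.
by rewrite leq_pmulr //; lia.
Qed.

(** For n = lambda s + gamma, the points x and n - s + x are joined by an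
    s-step across 0 on the cycle of length n, although they are far apart on
    the line.  The far point costs at least lambda - 1 long steps, and
    this makes up for the shift by gamma <= lambda of its remainder
    modulo s. *)
Lemma line_norm_wrap lambda gamma x :
    0 < lambda -> gamma <= lambda -> gamma < s -> x <= s ->
  line_norm s x <= (line_norm s (lambda * s + gamma - s + x)).+1.
Proof.
case: lambda => // l _ gamma_le gamma_lt x_le.
rewrite mulSnr; have [sum_le|sum_gt] := leqP (gamma + x) s.
  have -> : l * s + s + gamma - s + x = l * s + (gamma + x) by lia.
  by rewrite line_norm_small // line_normE //; lia.
have -> : l * s + s + gamma - s + x = l.+1 * s + (gamma + x - s) by lia.
by rewrite line_norm_small // line_normE //; lia.
Qed.

End LineNorm.

(** * Walks in circulant graphs *)

Definition circ_dist (n s v : nat) : nat :=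
  minn (line_norm s v) (line_norm s (n - v)).

Lemma circulantP n s (i j : 'I_n) : i <= j ->
  circulant n s i j = (i != j) &&
  ((minn (j - i) (n - (j - i)) == 1) || (minn (j - i) (n - (j - i)) == s)).
Proof.
move=> le_ij; rewrite /circulant /circ_norm !inE.
by have -> : `|(i%:Z - j%:Z)%R|%N = j - i by lia.
Qed.

Lemma circulant_sym n s : symmetric (circulant n s).
Proof.
move=> i j; rewrite /circulant /circ_norm eq_sym.
by have -> : `|(i%:Z - j%:Z)%R|%N = `|(j%:Z - i%:Z)%R|%N by lia.
Qed.

Section Circulant.

Variables n s : nat.
Hypothesis s_bounds : 2 <= s <= (n - 1) %/ 2.
Let s_ge2 : 2 <= s. Proof. by case/andP: s_bounds. Qed.

Lemma circulant_step t (i j : 'I_n) : t \in [:: 1; s] ->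
  i + t = j %[mod n] -> circulant n s i j.
Proof.
move=> t_in eq_mod.
have {}eq_mod : i + t = j \/ i + t = j + n.
  move: eq_mod; rewrite (modn_small (ltn_ord j)).
  have i_lt := ltn_ord i; have t_le : t <= n by move: t_in; rewrite !inE; lia.
  have [lt_n|ge_n] := ltnP (i + t) n; first by rewrite modn_small //; left.
  have -> : i + t = i + t - n + n by lia.
  by rewrite modnDr modn_small; lia.
move: t_in; rewrite !inE => t_in.
have [i_lt j_lt] := (ltn_ord i, ltn_ord j).
rewrite /circulant /circ_norm !inE -val_eqE /=.
have := s_bounds; lia.
Qed.

Lemma walk_steps t k (i j : 'I_n) : t \in [:: 1; s] ->
  i + k * t = j %[mod n] -> walk (circulant n s) k i j.
Proof.
move=> t_in; have n_gt0 : 0 < n by have := ltn_ord i; lia.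
elim: k i => [|k IHk] i.
  rewrite addn0 !modn_small ?ltn_ord // => /val_inj <-.
  by exists [::].
move=> eq_mod; pose m : 'I_n := Ordinal (ltn_pmod (i + t) n_gt0).
have [|p [pp lp sp]] := IHk m.
  by rewrite /= modnDml -addnA -mulSn.
exists (m :: p) => /=; rewrite pp lp sp andbT; split=> //.
by apply: circulant_step t_in _; rewrite /= modn_mod.
Qed.

Lemma walk_line_norm v (i j : 'I_n) : i + v = j %[mod n] ->
  walk (circulant n s) (line_norm s v) i j.
Proof.
have n_gt0 : 0 < n by have := ltn_ord i; lia.
have [in1 ins] : 1 \in [:: 1; s] /\ s \in [:: 1; s] by rewrite !inE !eqxx orbT.
have r_lt : v %% s < s by rewrite ltn_mod; lia.
rewrite {1}(divn_eq v s) /line_norm; set q := v %/ s; set r := v %% s in r_lt *.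
move=> eq_mod; have [r_small|r_big] := leqP r (s.+1 - r).
  pose m : 'I_n := Ordinal (ltn_pmod (i + q * s) n_gt0).
  apply: (@walk_cat _ _ _ _ _ m).
    by apply: walk_steps ins _; rewrite /= modn_mod.
  by apply: walk_steps in1 _; rewrite /= modnDml muln1 -addnA.
pose m : 'I_n := Ordinal (ltn_pmod (i + q.+1 * s) n_gt0).
have -> : q + (s.+1 - r) = q.+1 + (s - r) by lia.
apply: (@walk_cat _ _ _ _ _ m).
  by apply: walk_steps ins _; rewrite /= modn_mod.
apply: walk_sym (@circulant_sym n s) _.
apply: walk_steps in1 _; rewrite /= modn_mod muln1 -modnDml -eq_mod modnDml.
congr (_ %% _); lia.
Qed.

(** Walking by v from i to j, or by n - v from j to i. *)
Lemma gdist_le_circ_dist (i j : 'I_n) :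
  exists2 v, v < n & gdist (circulant n s) i j <= circ_dist n s v.
Proof.
have [i_lt j_lt] := (ltn_ord i, ltn_ord j); have n_gt0 : 0 < n by lia.
pose v := (j + (n - i)) %% n; have v_lt : v < n by rewrite ltn_mod.
have ij_eq : i + v = j %[mod n].
  by rewrite modnDmr (_ : i + (j + (n - i)) = j + n) ?modnDr //; lia.
exists v => //; rewrite leq_min; apply/andP; split; apply: walk_gdist_le.
  exact: walk_line_norm.
apply: walk_sym (@circulant_sym n s) _; apply: walk_line_norm.
rewrite -modnDml -ij_eq modnDml.
by rewrite (_ : i + v + (n - v) = i + n) ?modnDr //; lia.
Qed.

(** * The lower bound on distances *)

Variables lambda gamma : nat.
Hypothesis n_div : n = lambda * s + gamma.
Hypothesis gamma_lt : gamma < s.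
Hypothesis gamma_le : gamma <= lambda.

(** The vertices are cut open into the segment from 0 to n, on which a unit
    step or an s-step not crossing 0 moves both arguments of [circ_dist] by the
    length of the step.  Crossing 0 by an s-step links x <= s to n - s + x, and
    [line_norm s x] and [line_norm s (s - x)] differ by at most one; the other
    two costs do not get far below these, by [line_norm_wrap]. *)
Lemma circ_dist_lip (i j : 'I_n) :
  circulant n s i j -> circ_dist n s j <= (circ_dist n s i).+1.
Proof.
have lip x y : x < y -> y <= n ->
    (minn (y - x) (n - (y - x)) == 1) || (minn (y - x) (n - (y - x)) == s) ->
  circ_dist n s x <= (circ_dist n s y).+1 /\
  circ_dist n s y <= (circ_dist n s x).+1.
  move=> x_lt y_le step.
  have : [\/ y = x.+1, y = x + s, y = n - s + x | x <= 1 /\ y = n - 1 + x].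
    have := s_bounds.
    have [->|neq1] := eqVneq y x.+1; first by move=> _; apply: Or41.
    have [->|neq2] := eqVneq y (x + s); first by move=> _; apply: Or42.
    have [->|neq3] := eqVneq y (n - s + x); first by move=> _; apply: Or43.
    by move=> ?; apply: Or44; lia.
  rewrite /circ_dist; case=> [y_eq|y_eq|y_eq|[x_le y_eq]].
  - have [] := line_norm_succ s_ge2 x; have [] := line_norm_succ s_ge2 (n - y).
    have -> : (n - y).+1 = n - x by lia.
    by rewrite -y_eq; lia.
  - have := line_normDs s_ge2 x; have := line_normDs s_ge2 (n - y).
    have -> : n - y + s = n - x by lia.
    by rewrite -y_eq; lia.
  - have x_le : x <= s by lia.
    have lambda_gt0 : 0 < lambda.
      by move: s_bounds; rewrite n_div; case: (lambda) => //; lia.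
    have := line_norm_wrap s_ge2 lambda_gt0 gamma_le gamma_lt x_le.
    have := line_norm_wrap s_ge2 lambda_gt0 gamma_le gamma_lt (leq_subr x s).
    rewrite -n_div -y_eq.
    have -> : n - s + (s - x) = n - x by lia.
    have -> : n - y = s - x by lia.
    rewrite (line_norm_small s_ge2 x_le) (line_norm_small s_ge2 (leq_subr x s)).
    by clear -x_le; lia.
  - have -> : n - y = 1 - x by lia.
    have := line_norm_le s_ge2 x; have := line_norm_le s_ge2 (1 - x); lia.
move=> ij; have [lt_ij|lt_ji|/val_inj eq_ij] := ltngtP i j.
- move: ij; rewrite circulantP ?(ltnW lt_ij) // => /andP[_ /lip[]] //.
  exact: ltnW.
- move: ij; rewrite circulant_sym circulantP ?(ltnW lt_ji) //.
  by case/andP=> _ /lip[] //; exact: ltnW.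
- by rewrite eq_ij; lia.
Qed.

Lemma diam_circulant D :
    (forall v, v < n -> circ_dist n s v <= D) ->
    (exists2 v, v < n & D <= circ_dist n s v) ->
  diam (circulant n s) = D.
Proof.
move=> dist_le [v v_lt dist_ge]; apply/eqP; rewrite eqn_leq; apply/andP; split.
  apply/bigmax_leqP => i _; apply/bigmax_leqP => j _.
  by have [d d_lt /leq_trans->//] := gdist_le_circ_dist i j; apply: dist_le.
have n_gt0 : 0 < n by lia.
pose o : 'I_n := Ordinal n_gt0; pose w : 'I_n := Ordinal v_lt.
apply: leq_trans dist_ge _.
apply: leq_trans (leq_bigmax o); apply: leq_trans (leq_bigmax w).
apply: (gdist_ge_potential (f := fun i : 'I_n => circ_dist n s i)).
- exact: circ_dist_lip.
- by rewrite /= /circ_dist line_norm_small //; lia.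
- rewrite card_ord /circ_dist /=; have := line_norm_le s_ge2 v; lia.
Qed.

(** * Maximising the distance function *)

(** The complement n - v of v = q s + r has quotient lambda - q and remainder
    gamma - r when r <= gamma; a borrow makes them lambda - q - 1 and
    s + gamma - r when r >= gamma.  Both descriptions hold at r = gamma. *)
Lemma circ_dist_low q r : q <= lambda -> r <= gamma ->
  circ_dist n s (q * s + r) =
  minn (minn (q + r) (q + (s.+1 - r)))
    (minn (lambda - q + (gamma - r)) (lambda - q + (s.+1 - (gamma - r)))).
Proof.
move=> q_le r_le; rewrite /circ_dist.
have -> : n - (q * s + r) = (lambda - q) * s + (gamma - r).
  by have := leq_mul q_le (leqnn s); rewrite n_div mulnBl; lia.
by rewrite !line_normE ?addn_minr //; lia.
Qed.

Lemma circ_dist_high q r : q < lambda -> gamma <= r <= s ->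
  circ_dist n s (q * s + r) =
  minn (minn (q + r) (q + (s.+1 - r)))
    (minn (lambda - q.+1 + (s + gamma - r)) (lambda - q.+1 + (r.+1 - gamma))).
Proof.
move=> q_lt r_bd; rewrite /circ_dist.
have -> : n - (q * s + r) = (lambda - q.+1) * s + (s + gamma - r).
  by have := leq_mul q_lt (leqnn s); rewrite n_div mulnBl mulSn; lia.
have -> : r.+1 - gamma = s.+1 - (s + gamma - r) by lia.
by rewrite !line_normE ?addn_minr //; lia.
Qed.

Lemma diam_circulant_coords D :
    (forall q r, q <= lambda -> r <= gamma ->
       circ_dist n s (q * s + r) <= D) ->
    (forall q r, q < lambda -> gamma <= r < s ->
       circ_dist n s (q * s + r) <= D) ->
    (exists q r, q * s + r < n /\ D <= circ_dist n s (q * s + r)) ->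
  diam (circulant n s) = D.
Proof.
move=> low high [q [r [v_lt ge_D]]].
apply: diam_circulant; last by exists (q * s + r).
move=> v {}v_lt; have r_lt : v %% s < s by rewrite ltn_mod; lia.
have q_le : v %/ s <= lambda.
  have := leq_div2r s (ltnW v_lt).
  by rewrite n_div divnMDl ?(divn_small gamma_lt); lia.
rewrite (divn_eq v s); have [r_le|r_gt] := leqP (v %% s) gamma.
  exact: low.
apply: high; last lia.
rewrite ltn_neqAle q_le andbT; apply/eqP => q_eq.
by move: v_lt; rewrite (divn_eq v s) q_eq n_div; lia.
Qed.

End Circulant.

(** All the floors and ceilings of the formula become affine once s, gamma and
    lambda are written through their halves. *)
Lemma diam_circulant_halves (n s lambda gamma m k h : nat) (e : bool) :
    lambda = e + m.*2 -> s = k.*2 -> gamma = h.*2.+1 ->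
    n = lambda * s + gamma ->
    2 <= s <= (n - 1) %/ 2 -> gamma < s -> gamma < lambda ->
  diam (circulant n s) =
    if h == 0 then m + e + k.-1 else maxn (m + e + h) (m + (k - h)).
Proof.
move=> lambda_eq s_eq gamma_eq n_eq s_bounds gamma_lt gamma_lt_lambda.
have gamma_le := ltnW gamma_lt_lambda.
have low := circ_dist_low s_bounds n_eq gamma_lt gamma_le.
have high := circ_dist_high s_bounds n_eq gamma_lt gamma_le.
have lt_n q r : q < lambda -> r <= s -> q * s + r < n.
  move=> q_lt r_le; apply: leq_trans (_ : (q.+1 * s).+1 <= _).
    by rewrite ltnS mulSnr leq_add2l.
  by rewrite n_eq gamma_eq addnS ltnS -[q.+1 * s]addn0 leq_add // leq_mul.
have e_le1 := leq_b1 e.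
apply: (diam_circulant_coords s_bounds n_eq gamma_lt gamma_le).
- move=> q r q_le r_le.
  have := leqnn (circ_dist n s (q * s + r)); rewrite {2}low //.
  move: (circ_dist _ _ _) => d; rewrite !leq_min.
  case/andP=> /andP[dA _] /andP[dC _].
  have {dA dC} d_le : d.*2 <= lambda + gamma by lia.
  clear low high lt_n s_bounds n_eq.
  by case: (h =P 0) => [|_]; [lia | rewrite leq_max; apply/orP; left; lia].
- move=> q r q_lt /andP[r_ge r_lt].
  have := leqnn (circ_dist n s (q * s + r)).
  rewrite {2}high ?r_ge ?(ltnW r_lt) //.
  move: (circ_dist _ _ _) => d; rewrite !leq_min.
  case/andP=> /andP[dA dB] /andP[dE dC]; clear low high lt_n s_bounds n_eq.
  have d_le : d.*2 <= lambda + s.+1 - gamma by clear dA dE; lia.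
  (* For gamma = 1 and lambda even, d = (lambda + s) / 2 would make all four
     costs equal to d, but those in dA and dC have sum 2 r - 1 + lambda. *)
  case: (h =P 0) => [h0|_]; first by lia.
  rewrite leq_max; apply/orP; right.
  by clear -d_le lambda_eq s_eq gamma_eq e_le1; lia.
case: (h =P 0) => [h0|h_neq0].
(* Halving both coordinates brings the four costs within two of each other. *)
- exists m, k.
  rewrite high; [|lia..]; split; first by apply: lt_n; lia.
  clear low high lt_n s_bounds n_eq.
  by rewrite !leq_min; apply/andP; split; apply/andP; split; lia.
have [h_small|h_big] := leqP (m + e + h) (m + (k - h)).
(* With r fixed just above s / 2, q is chosen so that overshooting by one
   s-step costs exactly floor((lambda + s + 1 - gamma) / 2). *)
- exists (m - h), k.+1.
  rewrite high; [|lia..]; split; first by apply: lt_n; lia.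
  clear low high lt_n s_bounds n_eq.
  by rewrite !leq_min; apply/andP; split; apply/andP; split; lia.
(* Here the two direct costs r + q and (gamma - r) + (lambda - q) differ by at
   most one. *)
exists (m + e), h.
rewrite low; [|lia..]; split; first by apply: lt_n; lia.
clear low high lt_n s_bounds n_eq.
by rewrite !leq_min; apply/andP; split; apply/andP; split; lia.
Qed.

Theorem theorem3p13 (n s lambda gamma : nat)
  (hn : 5 <= n) (hs : 2 <= s <= (n - 1) %/ 2)
  (hdiv : n = lambda * s + gamma) (hgamma : gamma < s)
  (hodd : odd n) (heven : ~~ odd s)
  (hlam : gamma < lambda) (hpos : 0 < gamma) :
  diam (circulant n s) =
    if (gamma == 1) || (gamma == s - 1) then
      ceil_div lambda 2 + (s - 2) %/ 2
    else if 3 <= gamma <= 2 * ceil_div s 4 - 1 then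
      lambda %/ 2 + (s - gamma + 1) %/ 2
    else
      ceil_div lambda 2 + (gamma - 1) %/ 2.
Proof.
have gamma_odd : odd gamma.
  by move: hodd; rewrite hdiv oddD oddM (negbTE heven) andbF.
have s_halves : s = s./2.*2 by rewrite -[LHS]odd_double_half (negbTE heven).
have gamma_halves : gamma = (gamma./2).*2.+1.
  by rewrite -[LHS]odd_double_half gamma_odd.
have lambda_halves := odd_double_half lambda.
rewrite (diam_circulant_halves (esym lambda_halves) s_halves gamma_halves) //.
move: (s./2) (gamma./2) (lambda./2) (odd lambda)
  s_halves gamma_halves lambda_halves => k h m e s_eq gamma_eq lambda_eq.
clear hs hdiv heven hodd gamma_odd hn; subst s gamma lambda; rewrite /ceil_div.
have e_le1 := leq_b1 e.
have -> : (e + m.*2 + 2.-1) %/ 2 = m + e by clear -e_le1; lia.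
have -> : (e + m.*2) %/ 2 = m by clear -e_le1; lia.
have -> : (k.*2 - 2) %/ 2 = k.-1 by clear; lia.
have -> : (h.*2.+1 - 1) %/ 2 = h by clear; lia.
have -> : (k.*2 - h.*2.+1 + 1) %/ 2 = k - h by clear -hgamma; lia.
have [h0|h_neq0] := eqVneq h 0; first by rewrite h0.
have -> : (h.*2.+1 == 1) = false by clear -h_neq0; lia.
have [gamma_eq|gamma_neq] /= := eqVneq h.*2.+1 (k.*2 - 1).
  clear hlam; lia.
have small : (3 <= h.*2.+1 <= 2 * ((k.*2 + 4.-1) %/ 4) - 1) = (h.*2 < k).
  clear -h_neq0; lia.
rewrite small; case: ifP => h_k; clear small hlam; lia.
Qed.
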